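(* Let $\mathcal{K}\subseteq\mathbb{R}^d$ be a compact convex set and assume that there is some $D>0$ such that $\|x\|_1\le D$ holds for all $x\in\mathcal{K}$. Let $\{x_t\}$ be the sequence generated by the update rule (adaptive optimistic online mirror descent) $$x_{t+1}=\arg\min_{x\in\mathcal{K}}\ \langle g_t-h_t+h_{t+1},x\rangle+r_{t+1}(x)+\mathcal{B}_{\phi_{t+1}}(x,x_t)$$ for the sequence of subgradients $g_t\in\partial l_t(x_t)$ and a sequence of hints $\{h_t\}$, with the regulariser $$\phi_t:\mathbb{R}^d\to\mathbb{R},\quad \phi_t(x)=\alpha_t\sum_{i=1}^d\Big((|x_i|+\beta)\ln\Big(\frac{|x_i|}{\beta}+1\Big)-|x_i|\Big).$$ Setting $$\beta=\frac1d,\qquad \eta=\sqrt{\frac{1}{\ln(D+1)+\ln d}},\qquad \alpha_t=\eta\sqrt{\sum_{s=1}^{t-1}\|g_s-h_s\|_\infty^2},$$ we obtain $$\mathcal{R}_{1:T}\le r_1(x_1)+c(d,D)\sqrt{\sum_{t=1}^T\|g_t-h_t\|_\infty^2}$$ for some $c(d,D)\in\mathcal{O}\big(D\sqrt{\ln(D+1)+\ln d}\big)$.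
   Context: Online composite convex optimisation over $T$ rounds: in round $t$ the player chooses $x_t\in\mathcal{K}$, then a convex function $l_t:\mathcal{K}\to\mathbb{R}$ is revealed and the player suffers $f_t(x_t)$, where $f_t=l_t+r_t$ and $r_t:\mathbb{R}^d\to\mathbb{R}_{\ge0}$ is a known closed convex function. The regret is $\mathcal{R}_{1:T}=\sum_{t=1}^T f_t(x_t)-\min_{x\in\mathcal{K}}\sum_{t=1}^T f_t(x)$. The subgradient set is $\partial l_t(y)=\{g\in\mathbb{R}^d : l_t(x)-l_t(y)\ge\langle g,x-y\rangle\ \forall x\in\mathcal{K}\}$. The hints $h_t$ are vectors in $\mathbb{R}^d$. $\mathcal{B}_\phi(x,y)=\phi(x)-\phi(y)-\langle\nabla\phi(y),x-y\rangle$ is the Bregman divergence. $\|\cdot\|_1$ is the $\ell_1$ norm and $\|\cdot\|_\infty$ the maximum norm. The quantity $c(d,D)$ depends only on $d$ and $D$.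
   Formalization: The first round is fixed: either h_1=0 with x_1 in K arbitrary, or x_1 minimises <h_1,x>+r_1(x) over K; with x_1 and h_1 both arbitrary the bound fails (T=1, l_1(x)=x, g_1=h_1=1, r=0, x_1=D). The O is uniform in d>=1 and D>=delta for each delta>0. *)

(* Defs.v *)
From HB Require Import structures.
From mathcomp Require Import all_boot all_order all_algebra.
From mathcomp Require Import all_classical all_reals all_analysis.

Set Implicit Arguments.
Unset Strict Implicit.
Unset Printing Implicit Defensive.

Import Order.TTheory GRing.Theory Num.Theory.
Import numFieldNormedType.Exports.

Local Open Scope classical_set_scope.
Local Open Scope ring_scope.

(* R^d is 'rV[R]_d. Its library norm `|u| is the maximum norm, and its topology
   is the usual one. *)

Definition dot (R : realType) (d : nat) (u v : 'rV[R]_d) : R :=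
  \sum_(i < d) u 0 i * v 0 i.

Definition norm1 (R : realType) (d : nat) (u : 'rV[R]_d) : R :=
  \sum_(i < d) `|u 0 i|.

Definition argmin (T : Type) (R : realType) (K : set T) (F : T -> R) : set T :=
  [set x | K x /\ forall y, K y -> F x <= F y].

Definition subgradients (R : realType) (d : nat) (K : set 'rV[R]_d)
    (l : 'rV[R]_d -> R) (y : 'rV[R]_d) : set 'rV[R]_d :=
  [set g | forall x, K x -> dot g (x - y) <= l x - l y].

(* Closedness in the sense of convex analysis: the epigraph is closed. *)
Definition closed_function (R : realType) (d : nat) (r : 'rV[R]_d -> R) : Prop :=
  closed [set p : 'rV[R]_d * R | r p.1 <= p.2].

Definition grad (R : realType) (d : nat) (phi : 'rV[R]_d -> R) (y : 'rV[R]_d) :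
    'rV[R]_d :=
  \row_(i < d) 'D_(delta_mx 0 i) phi y.

Definition bregman (R : realType) (d : nat) (phi : 'rV[R]_d -> R)
    (x y : 'rV[R]_d) : R :=
  phi x - phi y - dot (grad phi y) (x - y).

Definition regulariser (R : realType) (d : nat) (alpha beta : R)
    (x : 'rV[R]_d) : R :=
  alpha * \sum_(i < d)
    ((`|x 0 i| + beta) * ln (`|x 0 i| / beta + 1) - `|x 0 i|).

Definition eta (R : realType) (d : nat) (D : R) : R :=
  Num.sqrt (1 / (ln (D + 1) + ln d%:R)).

(* Rounds are numbered from 1, so alpha_1 = 0 as an empty sum. *)
Definition alpha (R : realType) (d : nat) (D : R) (g h : nat -> 'rV[R]_d)
    (t : nat) : R :=
  eta d D * Num.sqrt (\sum_(1 <= s < t) `|g s - h s| ^+ 2).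

Definition phi (R : realType) (d : nat) (D : R) (g h : nat -> 'rV[R]_d)
    (t : nat) : 'rV[R]_d -> R :=
  regulariser (alpha D g h t) (1 / d%:R).

(* The quantity minimised over K to obtain x_{t+1} from x_t. *)
Definition update_objective (R : realType) (d : nat) (D : R)
    (r : nat -> 'rV[R]_d -> R) (x g h : nat -> 'rV[R]_d) (t : nat)
    (y : 'rV[R]_d) : R :=
  dot (g t - h t + h t.+1) y + r t.+1 y + bregman (phi D g h t.+1) y (x t).

(* The minimum over K is written as an infimum, which has the same value when
   the minimum is attained; convex losses on a compact set need not attain it. *)
Definition regret (R : realType) (d T : nat) (K : set 'rV[R]_d)
    (f : nat -> 'rV[R]_d -> R) (x : nat -> 'rV[R]_d) : R :=
  \sum_(1 <= t < T.+1) f t (x t)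
  - inf [set \sum_(1 <= t < T.+1) f t y | y in K].

(* c(d, D) is O(D sqrt(ln(D+1) + ln d)), jointly in d >= 1 and in D bounded away
   from 0: the implied constant may depend on the lower bound delta for D, but
   not on d and D. It cannot be uniform over all D > 0: already for d = 1,
   K = [-D, D], zero hints and losses y |-> +-y, the regret divided by the root
   of the sum of squares reaches the order of sqrt D when D tends to 0. *)
Definition c_bigO (R : realType) (c : nat -> R -> R) : Prop :=
  forall delta : R, 0 < delta ->
    let A := [set p : nat * R | (0 < p.1)%N /\ delta <= p.2] in
    let F := FilterType (globally A) (globally_filter A) in
    (fun p : nat * R => c p.1 p.2 : R^o)
    =O_F (fun p : nat * R => p.2 * Num.sqrt (ln (p.2 + 1) + ln p.1%:R) : R^o).

(* Main.v *)
Require Import Defs.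
From HB Require Import structures.
From mathcomp Require Import all_boot all_order all_algebra.
From mathcomp Require Import all_classical all_reals all_analysis.
From mathcomp Require Import ring lra.

Import Order.TTheory GRing.Theory Num.Theory.
Import numFieldNormedType.Exports.

Local Open Scope classical_set_scope.
Local Open Scope ring_scope.

(** The loss [l t + r t] is compared with a fixed point [u] of [K]. The
    subgradients replace [l t (x t) - l t u] by [dot (g t) (x t - u)], and with
    [a t := g t - h t] the sum of these inner products regroups as

      [dot (h 1) (x 1 - u)] + the sum over [t < T] of
      [dot (a t) (x t - x t.+1) + dot (a t + h t.+1) (x t.+1 - u)]
      + [dot (a T) (x T - u)],

    so that each update only pays for the surprise [a t], not for [g t].

    Optimality of [x t.+1] turns [dot (a t + h t.+1) (x t.+1 - u)], together with
    the [r]-terms of round [t.+1], into the Bregman divergences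
    [B(u, x t) - B(u, x t.+1) - B(x t.+1, x t)] of [phi t.+1]
    ([three_point_argmin]). Two estimates on the regulariser, whose curvature in
    a coordinate [s] is [alpha / (|s| + beta)], then give the bound.

    - It is strongly convex for the l1 norm, with modulus of order
      [alpha / (D + 1)] when [beta = 1/d] ([bregman_regulariser_ge_norm1]). Hence
      [dot (a t) (x t - x t.+1) - B(x t.+1, x t)] is at most a constant times
      [(D + 1) / eta] times the increment of the root of the sum of the squares
      [`|a s| ^+ 2] ([sqrt_increment]), and these increments telescope.
    - The divergence from [x t] to [u] is at most [alpha] times
      [3 D (ln (D + 1) + ln d)] ([sum_psi_bregman_le]), so that, [alpha] being
      nondecreasing, the differences [B(u, x t) - B(u, x t.+1)] also telescope.

    The inner product left over from the last round costs at most
    [2 D `|a T|]. With [1 / eta = sqrt (ln (D + 1) + ln d)] every term is of the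
    announced order.

    The estimates on the regulariser are obtained without second derivatives.
    In one coordinate its divergence from [r] to [s] is the relative entropy of
    [|s| + beta] and [|r| + beta] plus a nonnegative multiple of
    [|s| - sgn(r) s], and the square [(s - r)^2] decomposes in the same way
    ([psi_bregmanE], [sqr_sub_sg]). *)

(** * Relative entropy of two positive numbers *)

Lemma ln_le_subr1 {R : realType} (z : R) : 0 < z -> ln z <= z - 1.
Proof. by move=> z0; have := @le_ln1Dx R (z - 1); rewrite subrKC; apply; lra. Qed.

Lemma ln_ge_1Bv {R : realType} (z : R) : 0 < z -> 1 - z^-1 <= ln z.
Proof.
move=> z0; have zV0 : 0 < z^-1 by rewrite invr_gt0.
by have := ln_le_subr1 _ zV0; rewrite lnV ?posrE//; lra.
Qed.

Definition kl {R : realType} (a b : R) : R := a * ln (a / b) - a + b.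

Lemma kl_le {R : realType} (a b : R) : 0 < a -> 0 < b ->
  kl a b <= (a - b) ^+ 2 / b.
Proof.
move=> a0 b0; have ab0 : 0 < a / b by rewrite divr_gt0.
rewrite /kl -lerBrDr lerBlDr.
apply: (le_trans (ler_wpM2l (ltW a0) (ln_le_subr1 _ ab0))).
by rewrite le_eqVlt; apply/orP; left; apply/eqP; field; lra.
Qed.

(** With [a = p^2] and [b = q^2], the inequality [ln (p/q) >= 1 - q/p] makes the
    relative entropy dominate the squared Hellinger distance [(p - q)^2]. *)
Lemma kl_ge {R : realType} (a b : R) : 0 < a -> 0 < b ->
  (a - b) ^+ 2 / (2 * (a + b)) <= kl a b.
Proof.
move=> a0 b0.
have [p p0 pE] : exists2 p : R, 0 < p & a = p ^+ 2.
  by exists (Num.sqrt a); rewrite ?sqrtr_gt0// sqr_sqrtr// ltW.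
have [q q0 qE] : exists2 q : R, 0 < q & b = q ^+ 2.
  by exists (Num.sqrt b); rewrite ?sqrtr_gt0// sqr_sqrtr// ltW.
have pq0 : 0 < p / q by rewrite divr_gt0.
have lnE : ln (a / b) = ln (p / q) + ln (p / q).
  by rewrite -lnM ?posrE//; congr ln; rewrite pE qE; field; lra.
apply: (@le_trans _ _ ((p - q) ^+ 2)).
  rewrite pE qE ler_pdivrMr; last by nra.
  rewrite -subr_ge0.
  have -> : (p - q) ^+ 2 * (2 * (p ^+ 2 + q ^+ 2)) - (p ^+ 2 - q ^+ 2) ^+ 2
      = ((p - q) ^+ 2) ^+ 2 by ring.
  exact: sqr_ge0.
have H := ln_ge_1Bv _ pq0.
have : p ^+ 2 * (1 - (p / q)^-1) <= p ^+ 2 * ln (p / q).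
  by rewrite ler_pM2l// exprn_gt0.
have -> : p ^+ 2 * (1 - (p / q)^-1) = p ^+ 2 - p * q by field; lra.
by rewrite /kl lnE pE qE; lra.
Qed.

(** * The scalar potential *)

Definition psi {R : realType} (beta s : R) : R :=
  (`|s| + beta) * ln (`|s| / beta + 1) - `|s|.

Definition dpsi {R : realType} (beta s : R) : R :=
  Num.sg s * ln (`|s| / beta + 1).

Definition psi_bregman {R : realType} (beta s r : R) : R :=
  psi beta s - psi beta r - dpsi beta r * (s - r).

(** Dependence on the signs is confined to the gap [|s| - sgn(r) s], which
    vanishes when [s] and [r] are both positive or both negative; this treats
    both sides of the kink of the absolute value at once. *)
Lemma psi_bregmanE {R : realType} (beta s r : R) : 0 < beta ->
  psi_bregman beta s r = kl (`|s| + beta) (`|r| + beta)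
    + ln (`|r| / beta + 1) * (`|s| - Num.sg r * s).
Proof.
move=> b0; have s0 := normr_ge0 s; have r0 := normr_ge0 r.
have lnE (u : R) : 0 <= u -> ln (u / beta + 1) = ln (u + beta) - ln beta.
  move=> u0; rewrite -ln_div ?posrE; [|lra|lra].
  by congr ln; field; lra.
rewrite /psi_bregman /psi /dpsi /kl ln_div ?posrE; [|lra|lra].
by rewrite !lnE// (normrEsg r); ring.
Qed.

(** The splitting of the square that matches [psi_bregmanE] term by term. *)
Lemma sqr_sub_sg {R : realType} (s r : R) :
  (s - r) ^+ 2 = (`|s| - `|r|) ^+ 2 + 2 * `|r| * (`|s| - Num.sg r * s).
Proof.
have := @real_normK _ s (num_real s); have := @real_normK _ r (num_real r).
have : r = Num.sg r * `|r| by rewrite -numEsg.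
move: (Num.sg r) (`|s|) (`|r|) => e S P rE P2 S2.
transitivity (S ^+ 2 + P ^+ 2 - 2 * (e * P) * s); last by ring.
by rewrite P2 S2 -rE; ring.
Qed.

Lemma sg_gap_ge0 {R : realType} (s r : R) : 0 <= `|s| - Num.sg r * s.
Proof.
rewrite subr_ge0; apply: (le_trans (ler_norm _)).
rewrite normrM normr_sg; have := normr_ge0 s.
by case: (r != 0) => /=; rewrite ?mul1r ?mul0r.
Qed.

(** Smoothness of the potential, and in particular its differentiability at [0]:
    both terms of [psi_bregmanE] are bounded by [ln z <= z - 1]. *)
Lemma psi_bregman_le {R : realType} (beta s r : R) : 0 < beta ->
  psi_bregman beta s r <= (s - r) ^+ 2 / beta.
Proof.
move=> b0; rewrite psi_bregmanE// sqr_sub_sg.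
have s0 := normr_ge0 s; have r0 := normr_ge0 r.
have e0 := sg_gap_ge0 s r; move: (_ - Num.sg r * s) e0 => e e0.
have kl1 : kl (`|s| + beta) (`|r| + beta) <= (`|s| - `|r|) ^+ 2 / beta.
  apply: (@le_trans _ _ ((`|s| - `|r|) ^+ 2 / (`|r| + beta))).
    rewrite (_ : `|s| - `|r| = `|s| + beta - (`|r| + beta)); last by ring.
    by apply: kl_le; lra.
  by rewrite ler_wpM2l ?sqr_ge0// lef_pV2 ?posrE; lra.
have ln1 : ln (`|r| / beta + 1) * e <= `|r| / beta * e.
  rewrite ler_wpM2r// (le_trans (ln_le_subr1 _ _))//; last by rewrite addrK.
  by rewrite ltr_wpDl// divr_ge0// ltW.
have c0 : 0 <= `|r| / beta * e by rewrite mulr_ge0// divr_ge0// ltW.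
by rewrite mulrDl -!mulrA (mulrC e) !mulrA -(mulrA 2) -mulrA; lra.
Qed.

(** Strong convexity with a weight that depends on the two points. Both terms of
    [psi_bregmanE] are bounded below with the common denominator
    [|s| + |r| + 2 beta], and [sqr_sub_sg] reassembles the square. *)
Lemma psi_bregman_ge {R : realType} (beta s r : R) : 0 < beta ->
  (s - r) ^+ 2 / (2 * (`|s| + `|r| + 2 * beta)) <= psi_bregman beta s r.
Proof.
move=> b0; rewrite psi_bregmanE// sqr_sub_sg.
have s0 := normr_ge0 s; have r0 := normr_ge0 r.
have e0 := sg_gap_ge0 s r; move: (_ - Num.sg r * s) e0 => e e0.
rewrite mulrDl; apply: lerD.
  rewrite (_ : `|s| - `|r| = `|s| + beta - (`|r| + beta)); last by ring.
  rewrite (_ : `|s| + `|r| + 2 * beta = `|s| + beta + (`|r| + beta)).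
    by apply: kl_ge; lra.
  by ring.
have z0 : 0 < `|r| / beta + 1 by rewrite ltr_wpDl// divr_ge0// ltW.
have H := ln_ge_1Bv _ z0.
apply: (@le_trans _ _ (`|r| / (`|r| + beta) * e)); last first.
  rewrite ler_wpM2r//; apply: le_trans H.
  by rewrite le_eqVlt; apply/orP; left; apply/eqP; field; lra.
rewrite (_ : 2 * `|r| * e / _ = `|r| / (`|s| + `|r| + 2 * beta) * e); last first.
  by field; lra.
by rewrite ler_wpM2r// ler_wpM2l// lef_pV2 ?posrE; lra.
Qed.

Lemma psi_bregman_ge0 {R : realType} (beta s r : R) : 0 < beta ->
  0 <= psi_bregman beta s r.
Proof.
move=> b0; apply: le_trans (psi_bregman_ge _ _ _ b0).
by rewrite divr_ge0 ?sqr_ge0// mulr_ge0// !addr_ge0// mulr_ge0// ltW.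
Qed.

Lemma psi_ge0 {R : realType} (beta s : R) : 0 < beta -> 0 <= psi beta s.
Proof.
move=> b0; have s0 := normr_ge0 s.
have z0 : 0 < `|s| / beta + 1 by rewrite ltr_wpDl// divr_ge0// ltW.
rewrite /psi subr_ge0.
apply: (@le_trans _ _ ((`|s| + beta) * (1 - (`|s| / beta + 1)^-1))).
  by rewrite le_eqVlt; apply/orP; left; apply/eqP; field; lra.
by rewrite ler_wpM2l ?ln_ge_1Bv//; lra.
Qed.

(** The logarithm bounds the slope of the potential, so the divergence grows only
    linearly, which beats [psi_bregman_le] away from [r]. *)
Lemma psi_bregman_le_ln {R : realType} (beta L s r : R) : 0 < beta ->
  ln (`|s| / beta + 1) <= L -> ln (`|r| / beta + 1) <= L ->
  psi_bregman beta s r <= L * (2 * `|s| + `|r|).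
Proof.
move=> b0 sL rL; have s0 := normr_ge0 s; have r0 := normr_ge0 r.
have ln0 (u : R) : 0 <= ln (`|u| / beta + 1).
  by rewrite ln_ge0// lerDr divr_ge0// ltW.
have psis : psi beta s <= L * `|s|.
  have z0 : 0 < `|s| / beta + 1 by rewrite ltr_wpDl// divr_ge0// ltW.
  have : beta * ln (`|s| / beta + 1) <= beta * (`|s| / beta).
    by rewrite ler_pM2l//; have := ln_le_subr1 _ z0; rewrite addrK.
  have -> : beta * (`|s| / beta) = `|s| by field; lra.
  have : `|s| * ln (`|s| / beta + 1) <= `|s| * L by rewrite ler_wpM2l.
  by rewrite /psi; lra.
have dpsir : - (dpsi beta r * (s - r)) <= L * (`|s| + `|r|).
  apply: (le_trans (ler_norm _)); rewrite normrN normrM.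
  apply: ler_pM => //; last exact: ler_normB.
  rewrite /dpsi normrM normr_sg (ger0_norm (ln0 r)).
  by case: (r != 0); rewrite ?mul1r// mul0r (le_trans (ln0 r)).
by have := psi_ge0 _ r b0; rewrite /psi_bregman; lra.
Qed.

(** * Inner product and norms *)

Lemma dotDl {R : realType} {d} (u v w : 'rV[R]_d) :
  dot (u + v) w = dot u w + dot v w.
Proof.
by rewrite /dot -big_split/=; apply: eq_bigr => i _; rewrite mxE mulrDl.
Qed.

Lemma dotDr {R : realType} {d} (u v w : 'rV[R]_d) :
  dot u (v + w) = dot u v + dot u w.
Proof.
by rewrite /dot -big_split/=; apply: eq_bigr => i _; rewrite mxE mulrDr.
Qed.

Lemma dotZr {R : realType} {d} (a : R) (u v : 'rV[R]_d) :
  dot u (a *: v) = a * dot u v.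
Proof.
by rewrite /dot mulr_sumr; apply: eq_bigr => i _; rewrite mxE mulrCA.
Qed.

Lemma dotNr {R : realType} {d} (u v : 'rV[R]_d) : dot u (- v) = - dot u v.
Proof. by rewrite -scaleN1r dotZr mulN1r. Qed.

Lemma dotNl {R : realType} {d} (u v : 'rV[R]_d) : dot (- u) v = - dot u v.
Proof.
by rewrite /dot -sumrN; apply: eq_bigr => i _; rewrite mxE mulNr.
Qed.

Lemma dot_le_norm {R : realType} {d} (u v : 'rV[R]_d) :
  dot u v <= `|u| * norm1 v.
Proof.
rewrite /dot /norm1 mulr_sumr; apply: ler_sum => i _.
apply: (le_trans (ler_norm _)); rewrite normrM ler_wpM2r//.
rewrite [leRHS]/Num.norm /= mx_normrE; apply/bigmax_geP; right => /=.
by exists (0, i).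
Qed.

Lemma norm1_ge0 {R : realType} {d} (u : 'rV[R]_d) : 0 <= norm1 u.
Proof. exact: sumr_ge0. Qed.

Lemma norm1B_le {R : realType} {d} (u v : 'rV[R]_d) :
  norm1 (u - v) <= norm1 u + norm1 v.
Proof.
rewrite /norm1 -big_split/=; apply: ler_sum => i _.
by rewrite !mxE; exact: ler_normB.
Qed.

(** A weighted Cauchy-Schwarz inequality, summed from the tangent bounds
    [v^2 / w >= 2 k |v| - k^2 w] for the optimal slope [k]. *)
Lemma sqr_norm1_le {R : realType} {d} (v : 'rV[R]_d) (w : 'I_d -> R) :
  (forall i, 0 < w i) -> 0 < \sum_i w i ->
  norm1 v ^+ 2 / \sum_i w i <= \sum_i v 0 i ^+ 2 / w i.
Proof.
move=> w0 W0; set W := \sum_i w i; set V := norm1 v; pose k := V / W.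
have tangent i : 2 * k * `|v 0 i| - k ^+ 2 * w i <= v 0 i ^+ 2 / w i.
  have wi0 := w0 i.
  rewrite -(real_normK (num_real (v 0 i))) -subr_ge0.
  have -> : `|v 0 i| ^+ 2 / w i - (2 * k * `|v 0 i| - k ^+ 2 * w i)
      = (`|v 0 i| - k * w i) ^+ 2 / w i by field; lra.
  by rewrite divr_ge0 ?sqr_ge0// ltW.
apply: le_trans (ler_sum _ (fun i _ => tangent i)).
rewrite big_split/= sumrN -!mulr_sumr -/W -/(norm1 v) -/V /k.
by rewrite le_eqVlt; apply/orP; left; apply/eqP; field; rewrite /W; lra.
Qed.

(** * The regulariser and its Bregman divergence *)

(** A quadratic error bound identifies a directional derivative, so the kinks
    of the absolute values in the regulariser need no separate treatment. *)
Lemma derive_quadratic {R : realType} {V : normedModType R} (f : V -> R)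
    (a v : V) (k C : R) :
  (forall t, `|f (t *: v + a) - f a - t * k| <= C * t ^+ 2) ->
  'D_v f a = k.
Proof.
move=> fC; rewrite /derive; apply/cvg_lim => //.
apply/cvgrPdist_le => e e0.
have C1 : 0 < `|C| + 1 by have := normr_ge0 C; lra.
have neq0 : \forall t \near (0 : R)^', t != 0 by exact: nbhs_dnbhs_neq.
have small : \forall t \near (0 : R)^', `|t| <= e / (`|C| + 1).
  by apply: dnbhs0_le; exact: divr_gt0.
apply: filterS2 neq0 small => t t0 te /=.
rewrite distrC (_ : _ - k = t^-1 * (f (t *: v + a) - f a - t * k)); last first.
  by rewrite /GRing.scale/=; field.
rewrite normrM normfV ler_pdivrMl ?normr_gt0//.
apply: (le_trans (fC t)); rewrite -(real_normK (num_real t)).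
apply: (@le_trans _ _ ((`|C| + 1) * `|t| ^+ 2)).
  by rewrite ler_wpM2r ?sqr_ge0//; have := ler_norm C; lra.
by rewrite expr2 mulrCA ler_wpM2l// -ler_pdivlMl// mulrC.
Qed.

Lemma grad_regulariser {R : realType} {d} (al beta : R) (y : 'rV[R]_d) :
  0 < beta ->
  grad (regulariser al beta) y = \row_i (al * dpsi beta (y 0 i)).
Proof.
move=> b0; apply/rowP => i; rewrite !mxE.
apply: (@derive_quadratic _ _ _ _ _ _ (`|al| / beta)) => t.
have -> : regulariser al beta (t *: delta_mx 0 i + y) - regulariser al beta y
    - t * (al * dpsi beta (y 0 i)) = al * psi_bregman beta (t + y 0 i) (y 0 i).
  rewrite /regulariser -mulrBr -sumrB (bigD1 i)//= big1 ?addr0; last first.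
    move=> j ji; rewrite !mxE/= (negPf ji) mulr0 add0r subrr.
    by [].
  by rewrite !mxE/= ?eqxx mulr1 /psi_bregman /psi; ring.
rewrite normrM -mulrA ler_wpM2l// ger0_norm.
  by have := psi_bregman_le _ (t + y 0 i) (y 0 i) b0; rewrite addrK mulrC.
exact: psi_bregman_ge0.
Qed.

Lemma bregman_regulariser {R : realType} {d} (al beta : R) (u x : 'rV[R]_d) :
  0 < beta ->
  bregman (regulariser al beta) u x
  = al * \sum_i psi_bregman beta (u 0 i) (x 0 i).
Proof.
move=> b0; rewrite /bregman grad_regulariser// /regulariser /dot.
rewrite -mulrBr -sumrB !mulr_sumr -sumrB; apply: eq_bigr => i _.
by rewrite !mxE /psi_bregman /psi; ring.
Qed.

(** Supplies the second-order accuracy of the linear expansion that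
    [three_point_argmin] asks of the regulariser. *)
Lemma bregman_regulariser_le_dot {R : realType} {d} (al beta : R)
    (u x : 'rV[R]_d) : 0 < beta -> 0 <= al ->
  bregman (regulariser al beta) u x <= al / beta * dot (u - x) (u - x).
Proof.
move=> b0 al0; rewrite bregman_regulariser// -mulrA ler_wpM2l//.
rewrite /dot mulr_sumr; apply: ler_sum => i _.
by rewrite !mxE -expr2 mulrC; exact: psi_bregman_le.
Qed.

(** The weights of [psi_bregman_ge] add up to at most [4 (D + d beta)], whence
    a modulus that is free of [d] once [beta = 1/d]. *)
Lemma bregman_regulariser_ge_norm1 {R : realType} {d} (al beta D : R)
    (u x : 'rV[R]_d) : (0 < d)%N -> 0 < beta -> 0 <= al ->
  norm1 u <= D -> norm1 x <= D ->
  al * (norm1 (u - x) ^+ 2 / (4 * (D + d%:R * beta)))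
  <= bregman (regulariser al beta) u x.
Proof.
move=> d0 b0 al0 uD xD; rewrite bregman_regulariser// ler_wpM2l//.
pose w i := 2 * (`|u 0 i| + `|x 0 i| + 2 * beta).
have WE : \sum_i w i = 2 * (norm1 u + norm1 x + 2 * (d%:R * beta)).
  rewrite -mulr_sumr !big_split/= sumr_const card_ord -/(norm1 u) -/(norm1 x).
  by rewrite -[_ *+ d]mulr_natl; ring.
have w0 i : 0 < w i.
  by rewrite /w; have := normr_ge0 (u 0 i); have := normr_ge0 (x 0 i); lra.
have db0 : 0 < d%:R * beta by rewrite mulr_gt0// ltr0n.
have W0 : 0 < \sum_i w i.
  by rewrite WE; have := norm1_ge0 u; have := norm1_ge0 x; lra.
apply: (@le_trans _ _ (norm1 (u - x) ^+ 2 / \sum_i w i)).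
  rewrite ler_wpM2l ?sqr_ge0// lef_pV2 ?posrE//.
    by rewrite WE; lra.
  by have := norm1_ge0 u; lra.
apply: (le_trans (sqr_norm1_le _ _ w0 W0)); apply: ler_sum => i _.
by rewrite !mxE; exact: psi_bregman_ge.
Qed.

Lemma sum_psi_bregman_le {R : realType} {d} (beta L D : R) (u x : 'rV[R]_d) :
  0 < beta -> ln (D / beta + 1) <= L -> norm1 u <= D -> norm1 x <= D ->
  \sum_i psi_bregman beta (u 0 i) (x 0 i) <= 3 * D * L.
Proof.
move=> b0 DL uD xD.
have D0 : 0 <= D by exact: le_trans (norm1_ge0 u) uD.
have coord (v : 'rV[R]_d) i : norm1 v <= D -> ln (`|v 0 i| / beta + 1) <= L.
  move=> vD; apply: le_trans DL.
  rewrite ler_ln ?posrE; [|by rewrite ltr_wpDl// divr_ge0// ltW..].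
  rewrite lerD2r ler_pM2r ?invr_gt0//; apply: le_trans vD.
  by rewrite /norm1 (bigD1 i)//= lerDl sumr_ge0.
have L0 : 0 <= L.
  by apply: le_trans DL; rewrite ln_ge0// lerDr divr_ge0// ltW.
apply: (@le_trans _ _ (\sum_i L * (2 * `|u 0 i| + `|x 0 i|))).
  by apply: ler_sum => i _; apply: psi_bregman_le_ln => //; exact: coord.
rewrite -mulr_sumr big_split/= -mulr_sumr -/(norm1 u) -/(norm1 x).
by rewrite mulrC ler_wpM2r//; lra.
Qed.

(** * One step of mirror descent *)

Lemma ge0_of_quadratic {R : realType} (a b : R) :
  (forall t, 0 < t -> t <= 1 -> 0 <= t * a + t ^+ 2 * b) -> 0 <= a.
Proof.
move=> H; rewrite leNgt; apply/negP => a0.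
have b1 : 0 < `|b| + 1 - a by have := normr_ge0 b; lra.
(* For this [t] the quadratic term is smaller than the negative linear term. *)
pose t := - a / (`|b| + 1 - a).
have t0 : 0 < t by rewrite divr_gt0//; lra.
have t1 : t <= 1 by rewrite ler_pdivrMr//; have := normr_ge0 b; lra.
have := H t t0 t1; rewrite expr2 -mulrA -mulrDr pmulr_rge0//.
have tE : t * (`|b| + 1 - a) = - a by rewrite divfK//; lra.
have : t * b <= t * `|b| by rewrite ler_pM2l// ler_norm.
have : 0 < t * (1 - a) by rewrite mulr_gt0//; lra.
by lra.
Qed.

(** Moving from the minimiser [x'] towards [u] by a fraction [t] cannot decrease
    the objective. Convexity of [r] makes its change at most linear in [t], and
    the smoothness hypothesis makes that of [phi] linear up to [t^2]; letting [t]
    tend to [0] leaves the first-order condition, which the three-point identity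
    for Bregman divergences rewrites as the conclusion. *)
Lemma three_point_argmin {R : realType} {d} (K : set 'rV[R]_d)
    (r phi : 'rV[R]_d -> R) (w x x' u : 'rV[R]_d) (C : R) :
  convex_set K -> convex_function setT r ->
  (forall y, bregman phi y x' <= C * dot (y - x') (y - x')) ->
  argmin K (fun y => dot w y + r y + bregman phi y x) x' -> K u ->
  dot w (x' - u) + r x' - r u
  <= bregman phi u x - bregman phi u x' - bregman phi x' x.
Proof.
move=> cK cr smooth [Kx' minx'] Ku.
have [v vE] : exists v, v = u - x' by exists (u - x').
have -> : bregman phi u x - bregman phi u x' - bregman phi x' x
    = dot (grad phi x') v - dot (grad phi x) v.
  by rewrite /bregman vE !(dotDr, dotNr); ring.
suff : 0 <= dot w v + (r u - r x') + (dot (grad phi x') v - dot (grad phi x) v).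
  by rewrite vE !(dotDr, dotNr); lra.
apply: (@ge0_of_quadratic _ _ (C * dot v v)) => t t0 t1.
pose p : {i01 R} := Itv01 (ltW t0) t1.
pose y : 'rV[R]_d := t *: v + x'.
have yE : y = conv p (u : convex_lmodType _) (x' : convex_lmodType _).
  rewrite /y vE /conv/= /unstable.onem scalerBr scalerBl scale1r.
  by rewrite -addrA (addrC (- _)).
have Ky : K y.
  by have := cK u x' p (mem_set Ku) (mem_set Kx'); rewrite -yE => /set_mem.
have ry : r y <= t * r u + (1 - t) * r x'.
  have := cr p u x' (mem_set (I : setT u)) (mem_set (I : setT x')).
  by rewrite -yE convRE.
have := minx' y Ky; have := smooth y.
rewrite /bregman (_ : y - x' = t *: v); last by rewrite /y addrK.
rewrite (_ : y - x = t *: v + (x' - x)); last by rewrite /y addrA.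
rewrite /y !(dotDr, dotZr) -/y (_ : dot (t *: v) v = t * dot v v); last first.
  by rewrite /dot mulr_sumr; apply: eq_bigr => i _; rewrite mxE mulrA.
by lra.
Qed.

(** [p] and [q] are the roots of the sum of squares before and after adding
    [n ^ 2]. The left side is at most [M / e] times [n^2 / (2 q)] by completing
    the square, and [n^2 = (q - p) (q + p) <= 2 q (q - p)]. When [q = 0] there is
    no curvature, but then [n = 0] as well. *)
Lemma sqrt_increment {R : realType} (n rho q M e p : R) :
  0 < M -> 0 < e -> 0 <= p -> 0 <= q -> q ^+ 2 = p ^+ 2 + n ^+ 2 ->
  n * rho - e * q * (rho ^+ 2 / (2 * M)) <= M / e * (q - p).
Proof.
move=> M0 e0 p0 q0 qE.
have pq : p <= q.
  by rewrite -(@ler_pXn2r _ 2%N)// qE lerDl sqr_ge0.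
have [q00|qn0] := eqVneq q 0.
  have n0 : n = 0 by apply/eqP; rewrite -sqrf_eq0; apply/eqP; move: qE; nra.
  have -> : p = 0 by lra.
  by rewrite n0 q00; lra.
have q1 : 0 < q by rewrite lt_def qn0.
apply: (@le_trans _ _ (M / e * (n ^+ 2 / (2 * q)))).
  rewrite -subr_ge0.
  have -> : M / e * (n ^+ 2 / (2 * q)) - (n * rho - e * q * (rho ^+ 2 / (2 * M)))
      = (M * n - e * q * rho) ^+ 2 / (2 * M * e * q) by field; lra.
  by rewrite divr_ge0 ?sqr_ge0// !mulr_ge0// ltW.
rewrite ler_wpM2l//; first by rewrite divr_ge0// ltW.
by rewrite ler_pdivrMr; nra.
Qed.

(** * Accumulation over the rounds *)

Lemma ln_succ_add_ln_gt0 {R : realType} (d : nat) (D : R) : (0 < d)%N -> 0 < D ->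
  0 < ln (D + 1) + ln d%:R.
Proof.
move=> d0 D0; apply: ltr_wpDr; first by rewrite ln_ge0// ler1n.
by rewrite ln_gt0// ltrDr.
Qed.

Lemma etaE {R : realType} (d : nat) (D : R) : (0 < d)%N -> 0 < D ->
  Defs.eta d D = (Num.sqrt (ln (D + 1) + ln d%:R))^-1.
Proof. by move=> d0 D0; rewrite /Defs.eta div1r sqrtrV// ltW// ln_succ_add_ln_gt0. Qed.

(** The induction keeps the inner product of the current surprise
    [g n.+1 - h n.+1] pending, because it is only split at [x n.+2] by the next
    update. The last summand is the potential that makes the divergences
    telescope: it is nonnegative, so the growth of [alpha] from one round to the
    next can only increase it. *)
Lemma linear_regret_upto {R : realType} {d : nat} (T : nat) (D : R)
    (K : set 'rV[R]_d) (r : nat -> 'rV[R]_d -> R) (x g h : nat -> 'rV[R]_d)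
    (u : 'rV[R]_d) (n : nat) :
  (0 < d)%N -> 0 < D -> convex_set K ->
  (forall y, K y -> norm1 y <= D) ->
  (forall t, (1 <= t <= T)%N ->
     (forall y, 0 <= r t y) /\ convex_function setT (r t)) ->
  (h 1%N = 0 \/ argmin K (fun y => dot (h 1%N) y + r 1%N y) (x 1%N)) ->
  (forall t, (1 <= t <= T)%N -> K (x t)) ->
  (forall t, (1 <= t < T)%N ->
     argmin K (update_objective D r x g h t) (x t.+1)) ->
  K u -> (n < T)%N ->
  \sum_(1 <= t < n.+2) (dot (g t) (x t - u) + r t (x t) - r t u)
  <= r 1%N (x 1%N) + dot (g n.+1 - h n.+1) (x n.+1 - u)
     + 2 * (D + 1) / Defs.eta d D
       * Num.sqrt (\sum_(1 <= s < n.+1) `|g s - h s| ^+ 2)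
     + alpha D g h n.+1 * (3 * D * (ln (D + 1) + ln d%:R)
       - \sum_i psi_bregman (1 / d%:R) (u 0 i) (x n.+1 0 i)).
Proof.
move=> d0 D0 cK KD rT h1 Kx xmin Ku.
have dR0 : 0 < d%:R :> R by rewrite ltr0n.
have b0 : 0 < 1 / d%:R :> R by rewrite divr_gt0.
have eta0 : 0 < Defs.eta d D
  by rewrite etaE// invr_gt0 sqrtr_gt0 ln_succ_add_ln_gt0.
pose S t := \sum_(1 <= s < t) `|g s - h s| ^+ 2.
have S0 t : 0 <= S t by apply: sumr_ge0 => i _; exact: sqr_ge0.
have alphaE t : alpha D g h t = Defs.eta d D * Num.sqrt (S t) by [].
have alpha0 t : 0 <= alpha D g h t by rewrite alphaE mulr_ge0// ?sqrtr_ge0// ltW.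
elim: n => [T0|n IH nT].
  rewrite big_nat1 alphaE /S big_geq// sqrtr0 !mulr0 mul0r !addr0.
  have [r10 _] := rT 1%N T0; have := r10 u; have := r10 (x 1%N).
  (* In both cases [dot (h 1) (x 1 - u) <= r 1 u]. *)
  case: h1 => [-> | [_ /(_ _ Ku)]]; first by rewrite subr0; lra.
  by rewrite !(dotDl, dotDr, dotNl, dotNr); lra.
have {}IH := IH (ltnW nT).
rewrite -/(S n.+1) -/(S n.+2) [\sum_(1 <= t < n.+3) _]big_nat_recr//=.
have xK : norm1 (x n.+1) <= D by apply/KD/Kx; exact: ltnW.
have xK' : norm1 (x n.+2) <= D by exact/KD/Kx.
have opt : dot (g n.+1 - h n.+1 + h n.+2) (x n.+2 - u) + r n.+2 (x n.+2)
    - r n.+2 u <= bregman (phi D g h n.+2) u (x n.+1)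
    - bregman (phi D g h n.+2) u (x n.+2)
    - bregman (phi D g h n.+2) (x n.+2) (x n.+1).
  apply: (three_point_argmin K _ _ _ _ _ _ (alpha D g h n.+2 / (1 / d%:R))) => //.
  - by have [] := rT n.+2 nT.
  - by move=> y; exact: bregman_regulariser_le_dot.
  - exact: xmin.
have strong := bregman_regulariser_ge_norm1 _ _ _ _ _ d0 b0 (alpha0 n.+2) xK' xK.
have dual := dot_le_norm (g n.+1 - h n.+1) (x n.+1 - x n.+2).
have M0 : 0 < 2 * (D + 1) by lra.
have SS : Num.sqrt (S n.+2) ^+ 2
    = Num.sqrt (S n.+1) ^+ 2 + `|g n.+1 - h n.+1| ^+ 2.
  by rewrite !sqr_sqrtr// /S big_nat_recr.
have incr := sqrt_increment _ (norm1 (x n.+2 - x n.+1)) _ _ _ _ M0 eta0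
  (sqrtr_ge0 _) (sqrtr_ge0 _) SS.
have normC : norm1 (x n.+1 - x n.+2) = norm1 (x n.+2 - x n.+1).
  by apply: eq_bigr => i _; rewrite !mxE distrC.
have Dd : 4 * (D + d%:R * (1 / d%:R)) = 2 * (2 * (D + 1)).
  by rewrite div1r mulfV ?gt_eqF//; ring.
have grow : alpha D g h n.+1 <= alpha D g h n.+2.
  rewrite !alphaE ler_pM2l// ler_sqrt//.
  by rewrite /S [leRHS]big_nat_recr//= lerDl sqr_ge0.
have diam : \sum_i psi_bregman (1 / d%:R) (u 0 i) (x n.+1 0 i)
    <= 3 * D * (ln (D + 1) + ln d%:R).
  apply: sum_psi_bregman_le => //; last exact: KD.
  rewrite -lnM ?posrE//; last by lra.
  rewrite ler_ln ?posrE.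
  - by rewrite div1r invrK mulrDl mul1r lerD2l ler1n.
  - by rewrite div1r invrK; nra.
  - by rewrite mulr_gt0//; lra.
have slack : 0 <= 3 * D * (ln (D + 1) + ln d%:R)
    - \sum_i psi_bregman (1 / d%:R) (u 0 i) (x n.+1 0 i) by rewrite subr_ge0.
have tele := ler_wpM2r slack grow.
move: opt strong dual incr IH tele.
rewrite normC Dd /phi !bregman_regulariser// -alphaE.
rewrite !(dotDl, dotDr, dotNl, dotNr).
by lra.
Qed.

Lemma regret_le_of_linear {R : realType} {d : nat} (T : nat)
    (K : set 'rV[R]_d) (l r : nat -> 'rV[R]_d -> R) (x g : nat -> 'rV[R]_d)
    (B : R) :
  K !=set0 ->
  (forall t, (1 <= t <= T)%N -> subgradients K (l t) (x t) (g t)) ->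
  (forall u, K u ->
     \sum_(1 <= t < T.+1) (dot (g t) (x t - u) + r t (x t) - r t u) <= B) ->
  regret T K (fun t y => l t y + r t y) x <= B.
Proof.
move=> [k Kk] gl linB; rewrite /regret lerBlDl -lerBlDr; apply: lb_le_inf.
  by exists (\sum_(1 <= t < T.+1) (l t k + r t k)); exists k.
move=> _ [u Ku <-]; rewrite lerBlDr addrC -lerBlDr -sumrB.
have round t : (1 <= t <= T)%N ->
    l t (x t) + r t (x t) - (l t u + r t u)
    <= dot (g t) (x t - u) + r t (x t) - r t u.
  by move=> /gl/(_ u Ku); rewrite !(dotDr, dotNr); lra.
apply: le_trans (linB u Ku); rewrite big_nat_cond [leRHS]big_nat_cond.
by apply: ler_sum => t /andP[tT _]; exact: round.
Qed.

(** For [D >= delta] both [sqrt (ln (D + 1) + ln d)] and [D] are bounded away from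
    [0], so the terms [2 D] and [2 sqrt (ln (D + 1) + ln d)] are of the order of
    their product. *)
Lemma regret_constant_bigO {R : realType} :
  @c_bigO R (fun d D => 2 * D + (5 * D + 2) * Num.sqrt (ln (D + 1) + ln d%:R)).
Proof.
move=> delta delta0 /=; apply/eqO_exP.
have e0 : 0 < Num.sqrt (ln (delta + 1)).
  by rewrite sqrtr_gt0 ln_gt0// ltrDr.
exists (2 / Num.sqrt (ln (delta + 1)) + 5 + 2 / delta).
  by rewrite !addr_gt0 ?divr_gt0.
move=> [d D] /= [d0 deltaD].
have D0 : 0 < D by exact: lt_le_trans deltaD.
have sqrtL : Num.sqrt (ln (delta + 1)) <= Num.sqrt (ln (D + 1) + ln d%:R).
  rewrite ler_sqrt; last by rewrite ltW// ln_succ_add_ln_gt0.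
  apply: ler_wpDr; first by rewrite ln_ge0// ler1n.
  by rewrite ler_ln ?posrE; lra.
move: (Num.sqrt (ln (D + 1) + _)) sqrtL => s sqrtL.
move: (Num.sqrt _) e0 sqrtL => e e0 es.
have s0 : 0 < s by exact: lt_le_trans es.
rewrite !ger0_norm; [|by nra..].
have one_s : 1 <= s / e by rewrite ler_pdivlMr// mul1r.
have one_D : 1 <= D / delta by rewrite ler_pdivlMr// mul1r.
have : D <= D * (s / e) by rewrite ler_peMr// ltW.
have : s <= s * (D / delta) by rewrite ler_peMr// ltW.
by lra.
Qed.

(** [p] and [q] are the roots of the sums of squares without and with the last
    round, [s] is the inverse of [eta], and [w] is the inner product pending
    after the last round. *)
Lemma final_accounting {R : realType} (D p q s b w : R) :
  0 < D -> 0 <= p -> p <= q -> 0 < s -> 0 <= b -> w <= 2 * D * q ->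
  w + 2 * (D + 1) * s * p + s^-1 * p * (3 * D * s ^+ 2 - b)
  <= (2 * D + (5 * D + 2) * s) * q.
Proof.
move=> D0 p0 pq s0 b0 wq.
have -> : s^-1 * p * (3 * D * s ^+ 2 - b) = 3 * D * s * p - b * p / s.
  by field; lra.
have : 0 <= b * p / s by rewrite !mulr_ge0// invr_ge0 ltW.
have : (5 * D + 2) * s * p <= (5 * D + 2) * s * q.
  by rewrite ler_wpM2l// mulr_ge0//; lra.
by lra.
Qed.

Theorem theorem1 (R : realType) :
  exists c : nat -> R -> R,
    c_bigO c /\
    forall (d T : nat) (D : R) (K : set 'rV[R]_d)
      (l r : nat -> 'rV[R]_d -> R) (x g h : nat -> 'rV[R]_d),
      (0 < d)%N -> (0 < T)%N -> 0 < D ->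
      compact K -> convex_set K ->
      (forall y, K y -> norm1 y <= D) ->
      (forall t, (1 <= t <= T)%N -> convex_function K (l t)) ->
      (forall t, (1 <= t <= T)%N ->
         [/\ forall y, 0 <= r t y, closed_function (r t)
           & convex_function setT (r t)]) ->
      K (x 1%N) ->
      (h 1%N = 0 \/ argmin K (fun y => dot (h 1%N) y + r 1%N y) (x 1%N)) ->
      (forall t, (1 <= t <= T)%N -> subgradients K (l t) (x t) (g t)) ->
      (forall t, (1 <= t < T)%N ->
         argmin K (update_objective D r x g h t) (x t.+1)) ->
      regret T K (fun t y => l t y + r t y) x
      <= r 1%N (x 1%N)
         + c d D * Num.sqrt (\sum_(1 <= t < T.+1) `|g t - h t| ^+ 2).
Proof.
exists (fun d D => 2 * D + (5 * D + 2) * Num.sqrt (ln (D + 1) + ln d%:R)).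
split; first exact: regret_constant_bigO.
move=> d T D K l r x g h d0 T0 D0 _ cK KD _ rT Kx1 h1 gl xmin.
have Kx t : (1 <= t <= T)%N -> K (x t).
  case: t => [//|[//|t]] tT; by have [] := xmin t.+1 tT.
have rT' t : (1 <= t <= T)%N ->
    (forall y, 0 <= r t y) /\ convex_function setT (r t).
  by move=> /rT[].
apply: (regret_le_of_linear _ _ _ _ _ g) => //; first by exists (x 1%N).
move=> u Ku; case: T T0 {rT} rT' gl xmin Kx => // n _ rT gl xmin Kx.
have xK : norm1 (x n.+1) <= D by apply/KD/Kx; rewrite /= leqnn.
have uK := KD u Ku.
apply: (le_trans (linear_regret_upto _ _ _ _ _ _ _ _ _ d0 D0 cK KD rT h1 Kx xmin
  Ku (ltnSn n))).
set S := \sum_(1 <= s < n.+2) _; rewrite -[leLHS]addrA -[leLHS]addrA lerD2l addrA.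
have SE : S = \sum_(1 <= s < n.+1) `|g s - h s| ^+ 2
    + `|g n.+1 - h n.+1| ^+ 2 by rewrite /S big_nat_recr.
have S'0 : 0 <= \sum_(1 <= s < n.+1) `|g s - h s| ^+ 2.
  by apply: sumr_ge0 => i _; exact: sqr_ge0.
have L0 := ln_succ_add_ln_gt0 d D d0 D0.
have LL := sqr_sqrtr (ltW L0).
have sL0 : 0 < Num.sqrt (ln (D + 1) + ln d%:R) by rewrite sqrtr_gt0.
have S'S : Num.sqrt (\sum_(1 <= s < n.+1) `|g s - h s| ^+ 2) <= Num.sqrt S.
  by rewrite ler_wsqrtr// SE lerDl sqr_ge0.
have last_round : dot (g n.+1 - h n.+1) (x n.+1 - u) <= 2 * D * Num.sqrt S.
  apply: (le_trans (dot_le_norm _ _)); rewrite mulrC.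
  apply: ler_pM; rewrite ?norm1_ge0//.
    by apply: (le_trans (norm1B_le _ _)); lra.
  by rewrite -[leLHS]ger0_norm// -sqrtr_sqr ler_wsqrtr// SE lerDr.
have b0 : 0 < 1 / d%:R :> R by rewrite divr_gt0// ltr0n.
have breg0 : 0 <= \sum_i psi_bregman (1 / d%:R) (u 0 i) (x n.+1 0 i).
  by apply: sumr_ge0 => i _; exact: psi_bregman_ge0.
rewrite /alpha etaE// invrK -[X in _ * (3 * D * X - _)]LL.
exact: final_accounting.
Qed.
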